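(* Consider the Gaussian linear regression model $\mathbf{y}=X\boldsymbol{\beta}+\boldsymbol{\epsilon}$ with $X\in\mathbb{R}^{n\times p}$, $r=\mathrm{rank}(X)$, any $r$ columns of $X$ linearly independent, $\boldsymbol{\beta}\in\mathbb{R}^p$ and $\boldsymbol{\epsilon}\sim N(\mathbf{0},\sigma^2 I_n)$ with known $\sigma^2>0$. Let $\gamma>0$, $c(\gamma)=8(\gamma+3/4)^2$, and let $\pi$ be a probability distribution on $\{0,1,\dots,r\}$ with $\pi(k)>0$ for all $k$, satisfying $$\pi(k)\le \binom{p}{k}e^{-c(\gamma)k},\quad k=0,\dots,r-1,\qquad\text{and}\qquad \pi(r)\le e^{-c(\gamma)r}.$$ Let $\hat M$ be a solution of $$\|\mathbf{y}-X\hat{\boldsymbol{\beta}}_M\|^2+Pen(|M|)\to\min_M ,$$ where $$Pen(k)=2\sigma^2(1+1/\gamma)\ln\left\{\binom{p}{k}\pi(k)^{-1}(1+\gamma)^{k/2}\right\},\quad k=0,\dots,r-1,$$ $$Pen(r)=2\sigma^2(1+1/\gamma)\ln\left\{\pi(r)^{-1}(1+\gamma)^{r/2}\right\},$$ and let $\hat{\boldsymbol{\beta}}_{\hat M}$ be the corresponding least squares estimate. Then $$E\|X\hat{\boldsymbol{\beta}}_{\hat M}-X\boldsymbol{\beta}\|^2\le c_0(\gamma)\inf_M\left\{\|X\boldsymbol{\beta}_M-X\boldsymbol{\beta}\|^2+Pen(|M|)\right\}+c_1(\gamma)\sigma^2$$ for some constants $c_0(\gamma)$ and $c_1(\gamma)$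 depending only on $\gamma$.
   Context: A model $M$ is a subset of the $p$ predictors (columns of $X$), with $|M|$ its size; only models with $|M|\le r$ are considered (the prior $\pi$ gives zero mass to sizes larger than $r$), and both the minimization and the infimum over $M$ are over these models. All models of size $r$ give the same estimate of the mean vector $X\boldsymbol{\beta}$ and are identified with a single saturated model. $D_M$ is the $p\times p$ diagonal matrix with $j$th diagonal entry equal to $1$ if the $j$th predictor belongs to $M$ and $0$ otherwise. The least squares estimate for $M$ is $\hat{\boldsymbol{\beta}}_M=(D_MX'XD_M)^{+}D_MX'\mathbf{y}$, where $^{+}$ denotes the generalized inverse; thus $X\hat{\boldsymbol{\beta}}_M$ is the orthogonal projection of $\mathbf{y}$ on the span of the columns of $X$ in $M$. $X\boldsymbol{\beta}_M$ denotes the orthogonal projection of $X\boldsymbol{\beta}$ on the same span. $\|\cdot\|$ is the Euclidean norm and $E$ is the expectation with respect to $\boldsymbol{\epsilon}$. *)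

(* Defs.v *)
From HB Require Import structures.
From mathcomp Require Import all_boot all_order all_algebra.
From mathcomp Require Import all_classical all_reals all_analysis.
Set Implicit Arguments.
Unset Strict Implicit.
Unset Printing Implicit Defensive.
Import Order.TTheory GRing.Theory Num.Theory.
Import numFieldNormedType.Exports.
Local Open Scope classical_set_scope.
Local Open Scope ring_scope.

(* The canonical norm `|v| on matrices is the sup norm, hence this definition
   of the square of the Euclidean norm. *)
Definition sqnorm {R : realType} {n : nat} (v : 'cV[R]_n) : R :=
  \sum_(i < n) v i 0 ^+ 2.

Section GeneralizedInverse.
Context {R : realType}.

Definition is_mpinv {m n : nat} (A : 'M[R]_(m, n)) (G : 'M[R]_(n, m)) : Prop :=
  [/\ A *m G *m A = A, G *m A *m G = G,
      (A *m G)^T = A *m G & (G *m A)^T = G *m A].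

(* The default value is never used, by [mpinvP]. *)
Definition mpinv {m n : nat} (A : 'M[R]_(m, n)) : 'M[R]_(n, m) :=
  xget 0 [set G | is_mpinv A G].

(* Orthogonal projection of [v] on the column span of [Z]: vectors of [kermx Z]
   are the rows orthogonal to all columns of [Z]. *)
Definition orthproj {n p : nat} (Z : 'M[R]_(n, p)) (v : 'cV[R]_n) : 'cV[R]_n :=
  (v^T *m proj_mx <<Z^T>>%MS (kermx Z))^T.

Lemma gram_eq0 m n (B : 'M[R]_(m, n)) : B *m B^T = 0 -> B = 0.
Proof.
move=> BB0; apply/matrixP => i j; rewrite [RHS]mxE.
have /matrixP/(_ i i) := BB0; rewrite !mxE => /eqP.
rewrite psumr_eq0 => [/allP/(_ j)|k _]; last by rewrite mxE -expr2 sqr_ge0.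
by rewrite mem_index_enum mxE mulf_eq0 orbb => /(_ isT)/eqP.
Qed.

Lemma gram_unit m n (B : 'M[R]_(m, n)) : row_free B -> B *m B^T \in unitmx.
Proof.
move=> Bfree; rewrite -row_free_unit -kermx_eq0; apply/eqP.
have /gram_eq0 KB0 : (kermx (B *m B^T) *m B) *m (kermx (B *m B^T) *m B)^T = 0.
  by rewrite trmx_mul mulmxA -(mulmxA _ B) mulmx_ker mul0mx.
by apply: (row_free_inj Bfree); rewrite KB0 mul0mx.
Qed.

Lemma full_rank_mpinv m n k (A : 'M[R]_(m, n)) (C : 'M[R]_(m, k))
    (B : 'M[R]_(k, n)) :
  row_free C^T -> row_free B -> A = C *m B ->
  is_mpinv A (B^T *m invmx (B *m B^T) *m (invmx (C^T *m C) *m C^T)).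
Proof.
move=> /gram_unit; rewrite trmxK => uC /gram_unit uB AE.
pose G := B^T *m invmx (B *m B^T) *m (invmx (C^T *m C) *m C^T).
have AG : A *m G = C *m invmx (C^T *m C) *m C^T.
  rewrite AE /G -!mulmxA; congr (_ *m _); rewrite !mulmxA.
  by rewrite mulmxV // mul1mx.
have GA : G *m A = B^T *m invmx (B *m B^T) *m B.
  rewrite AE /G -!mulmxA; congr (_ *m (_ *m _)).
  by rewrite (mulmxA C^T) mulmxA mulVmx // mul1mx.
split.
- by rewrite AG AE mulmxA -2!(mulmxA C) -(mulmxA (invmx _)) mulVmx // mulmx1.
- rewrite GA /G 2!mulmxA; congr (_ *m _); congr (_ *m _).
  by rewrite -2!(mulmxA (B^T)) -(mulmxA (invmx _)) mulVmx // mulmx1.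
- by rewrite AG !trmx_mul trmx_inv trmx_mul !trmxK mulmxA.
- by rewrite GA !trmx_mul trmx_inv trmx_mul !trmxK mulmxA.
Qed.

Lemma mpinv_exists m n (A : 'M[R]_(m, n)) : exists G, is_mpinv A G.
Proof.
eexists; apply: full_rank_mpinv (row_base_free A) (esym (mulmx_base A)).
by rewrite /row_free mxrank_tr; have := col_base_full A; rewrite /row_full.
Qed.

Lemma mpinv_uniq m n (A : 'M[R]_(m, n)) G H :
  is_mpinv A G -> is_mpinv A H -> G = H.
Proof.
move=> [AGA GAG sAG sGA] [AHA HAH sAH sHA].
have E1 : A *m G = A *m H.
  rewrite -{1}AHA -(mulmxA (A *m H)) -sAG -sAH -trmx_mul.
  by rewrite mulmxA AGA.
have E2 : G *m A = H *m A.
  rewrite -{1}AHA -mulmxA mulmxA -sGA -sHA -trmx_mul.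
  by rewrite -mulmxA (mulmxA A) AGA.
by rewrite -GAG -mulmxA E1 mulmxA E2 HAH.
Qed.

Lemma mpinvP m n (A : 'M[R]_(m, n)) : is_mpinv A (mpinv A).
Proof. by have [G AG] := mpinv_exists A; exact: (xgetPex 0 (ex_intro _ G AG)). Qed.

Lemma gram_mpinv n p (Z : 'M[R]_(n, p)) :
  Z^T *m Z *m mpinv (Z^T *m Z) *m Z^T = Z^T.
Proof.
have [AGA _ _ _] := mpinvP (Z^T *m Z).
set G := mpinv _ in AGA *.
pose W := Z^T *m Z *m G *m Z^T - Z^T.
have WZ : W *m Z = 0 by rewrite mulmxBl -(mulmxA _ Z^T) AGA subrr.
suff W0 : W = 0 by apply/eqP; rewrite -subr_eq0 -/W W0.
apply: gram_eq0; rewrite {2}/W raddfB /= trmx_mul trmxK mulmxBr mulmxA WZ.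
by rewrite mul0mx subr0.
Qed.

Lemma gram_normal_eq n p (Z : 'M[R]_(n, p)) (v : 'cV[R]_n) :
  Z^T *m (v - Z *m (mpinv (Z^T *m Z) *m Z^T *m v)) = 0.
Proof. by rewrite mulmxBr !mulmxA gram_mpinv subrr. Qed.

Lemma orthprojE n p (Z : 'M[R]_(n, p)) (v w : 'cV[R]_n) (a : 'cV[R]_p) :
  w = Z *m a -> Z^T *m (v - w) = 0 -> orthproj Z v = w.
Proof.
move=> wE /(congr1 trmx); rewrite trmx_mul trmxK trmx0 => wo.
have dx : (<<Z^T>> :&: kermx Z = 0)%MS.
  apply/eqP/rowV0P => u; rewrite sub_capmx genmxE => /andP[/submxP[b uE]].
  move/sub_kermxP => uZ; apply: gram_eq0.
  by rewrite {2}uE trmx_mul trmxK mulmxA uZ mul0mx.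
rewrite /orthproj -[v](subrK w) raddfD mulmxDl /=.
rewrite (proj_mx_0 dx) ?(proj_mx_id dx) ?add0r ?trmxK //.
  by rewrite genmxE wE trmx_mul submxMl.
exact/sub_kermxP.
Qed.

End GeneralizedInverse.

Section Models.
Context {R : realType} {n p : nat}.
Implicit Types (X : 'M[R]_(n, p)) (M : {set 'I_p}).

Definition sel_mx M : 'M[R]_p := diag_mx (\row_j (j \in M)%:R).

Definition lse X M (y : 'cV[R]_n) : 'cV[R]_p :=
  mpinv (sel_mx M *m X^T *m X *m sel_mx M) *m (sel_mx M *m X^T) *m y.

Definition model_proj X M (v : 'cV[R]_n) : 'cV[R]_n :=
  orthproj (X *m sel_mx M) v.

Lemma model_proj_lse X M y : X *m lse X M y = model_proj X M y.
Proof.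
have sDD : sel_mx M *m sel_mx M = sel_mx M.
  rewrite /sel_mx mul_diag_mx; apply/matrixP => i j; rewrite !mxE.
  by case: (i \in M); case: (i == j); rewrite ?mulr0 ?mulr1 ?mul0r ?mulr0n.
have sT : (sel_mx M)^T = sel_mx M by rewrite /sel_mx tr_diag_mx.
pose Z := X *m sel_mx M.
have ZT : Z^T = sel_mx M *m X^T by rewrite trmx_mul sT.
have lE : lse X M y = mpinv (Z^T *m Z) *m Z^T *m y by rewrite /lse ZT /Z !mulmxA.
have DG : sel_mx M *m mpinv (Z^T *m Z) = mpinv (Z^T *m Z).
  have [_ GAG _ sGA] := mpinvP (Z^T *m Z).
  move: (mpinv _) GAG sGA => G GAG sGA.
  have GE : G = Z^T *m (Z *m G^T *m G).
    by rewrite -{1}GAG -sGA !trmx_mul !trmxK !mulmxA ?trmxK.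
  have DZ : sel_mx M *m Z^T = Z^T by rewrite ZT mulmxA sDD.
  by rewrite GE [LHS]mulmxA DZ.
have XE : X *m lse X M y = Z *m lse X M y.
  by rewrite lE -[in LHS]DG !mulmxA.
symmetry; apply: (orthprojE XE).
by rewrite XE lE gram_normal_eq.
Qed.

(* With [r = \rank X], all sets of [r] predictors have the same projection and
   count as one saturated model, hence no binomial coefficient at [k = r]; as
   sets they tie in [is_solution] and in [oracle_risk]. *)
Definition penalty (gamma sigma : R) (r : nat) (prior : nat -> R) (k : nat) : R :=
  2 * sigma ^+ 2 * (1 + gamma^-1) *
  ln ((if (k < r)%N then 'C(p, k)%:R else 1) * (prior k)^-1
      * (1 + gamma) `^ (k%:R / 2)).

Definition is_solution X (r : nat) (pen : nat -> R) (y : 'cV[R]_n) M : Prop :=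
  (#|M| <= r)%N /\
  forall M' : {set 'I_p}, (#|M'| <= r)%N ->
    sqnorm (y - X *m lse X M y) + pen #|M|
      <= sqnorm (y - X *m lse X M' y) + pen #|M'|.

Definition oracle_risk X (r : nat) (pen : nat -> R) (beta : 'cV[R]_p) : R :=
  inf [set sqnorm (model_proj X M (X *m beta) - X *m beta) + pen #|M|
      | M in [set M : {set 'I_p} | (#|M| <= r)%N]].

End Models.

Section GaussianNoise.
Context {d : measure_display} {T : measurableType d} {R : realType}.

Definition mutually_independent (P : probability T R) (I : finType)
    (Z : I -> {RV P >-> R}) : Prop :=
  forall (J : {set I}) (A : I -> set R), (forall i, measurable (A i)) ->
    (P (\bigcap_(i in [set` J]) (Z i @^-1` A i))
     = \prod_(i in J) P (Z i @^-1` A i))%E.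

(* [N(0, sigma^2 I_n)] as the law with independent [N(0, sigma^2)] coordinates;
   the second parameter of [normal_prob] is the standard deviation. *)
Definition gaussian_noise (P : probability T R) (n : nat) (sigma : R)
    (eps : 'I_n -> {RV P >-> R}) : Prop :=
  (forall i (A : set R), measurable A ->
     distribution P (eps i) A = normal_prob 0 sigma A) /\
  mutually_independent eps.

End GaussianNoise.

(* Main.v *)
(* Let [mu = X beta], let [Q_M] be the orthogonal projector of model [M] and
   put [theta = 1 - rho], where [rho = 1 / (2 (1 + gamma))].  Comparing the
   criterion at [Mhat] and at a fixed model [M] bounds [rho |X betahat - mu|^2]
   by [|Q_M mu - mu|^2 + pen M + 2 <eps, mu - Q_M mu> + Z_Mhat], where
     [Z_M = (2 - theta) |Q_M eps|^2 + 2 <eps, Q_M mu - mu>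
            - theta |Q_M mu - mu|^2 - pen M].
   For [t = theta / (2 sigma^2)] the linear part of [t Z_M] has a Gaussian
   exponential moment that cancels [t theta |Q_M mu - mu|^2], while the
   quadratic part contributes at most [rho^-|M|].  The assumption on the prior
   makes [rho^-|M| exp (- t pen M)] at most the prior mass of [M], so that
   [sum_M exp (t Z_M)] has expectation at most 1, and
   [Z_Mhat <= t^-1 exp (t Z_Mhat)].  The remaining linear term is absorbed in
   the same way at the cost of one more [|Q_M mu - mu|^2], which avoids any
   integrability question for signed functions. *)
Require Import Defs.
From HB Require Import structures.
From mathcomp Require Import all_boot all_order all_algebra.
From mathcomp Require Import all_classical all_reals all_analysis.
From mathcomp Require Import measurable_realfun ring lra.
Set Implicit Arguments.
Unset Strict Implicit.
Unset Printing Implicit Defensive.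
Import Order.TTheory GRing.Theory Num.Theory.
Import numFieldNormedType.Exports.
Local Open Scope classical_set_scope.
Local Open Scope ring_scope.

(* Needed without measurability of [f]: the selected model is an arbitrary
   function of the noise. *)
Lemma ge0_le_integral_nonmeasurable d (T : measurableType d) (R : realType)
    (mu : {measure set T -> \bar R}) (f g : T -> \bar R) :
  (forall x, 0 <= f x)%E -> (forall x, f x <= g x)%E ->
  (\int[mu]_x f x <= \int[mu]_x g x)%E.
Proof.
move=> f0 fg.
have g0 x : (0 <= g x)%E := le_trans (f0 x) (fg x).
rewrite !ge0_integralE // !patch_setT; apply: ge_ereal_sup => _ [h hf <-].
by apply: ereal_sup_ubound; exists h => // x; apply: le_trans (fg x).
Qed.

(** * Integration against the image of a weighted measure *)

Section ChangeOfVariables.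
Context d1 d2 (T1 : measurableType d1) (T2 : measurableType d2) (R : realType).
Variables (mu : {measure set T1 -> \bar R}) (nu : {measure set T2 -> \bar R}).
Variables (Z : T1 -> T2) (w : T1 -> R).
Hypothesis mZ : measurable_fun setT Z.
Hypothesis mw : measurable_fun setT w.

Hypothesis w0 : forall x, 0 <= w x.
Hypothesis nuE : forall A, measurable A ->
  nu A = (\int[mu]_(x in Z @^-1` A) (w x)%:E)%E.

Local Open Scope ereal_scope.

Import HBNNSimple.

Let mwE : measurable_fun setT (fun x => (w x)%:E : \bar R).
Proof. exact/measurable_EFinP. Qed.

Let wE0 x : 0 <= (w x)%:E. Proof. by rewrite lee_fin. Qed.

Let integral_density_indic A (mA : measurable A) :
  \int[nu]_x (\1_A x)%:E = \int[mu]_x ((\1_A (Z x))%:E * (w x)%:E).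
Proof.
rewrite integral_indic// setIT nuE// integral_mkcond.
apply: eq_integral => x _; rewrite patchE indicE.
have -> : (x \in Z @^-1` A) = (Z x \in A).
  by apply/idP/idP; rewrite !inE.
by case: ifP; rewrite ?mul1e ?mul0e.
Qed.

Let integral_density_nnsfun (f : {nnsfun T2 >-> R}) :
  \int[nu]_x (f x)%:E = \int[mu]_x ((f (Z x))%:E * (w x)%:E).
Proof.
under [LHS]eq_integral do rewrite fimfunE -fsumEFin//.
rewrite [LHS]ge0_integral_fsum//; last 2 first.
  - by move=> r; exact/measurable_EFinP/measurableT_comp.
  - by move=> n x _; rewrite EFinM nnfun_muleindic_ge0.
under [RHS]eq_integral.
  move=> x xD; rewrite fimfunE -fsumEFin// ge0_mule_fsuml; last first.
    by move=> r; rewrite EFinM nnfun_muleindic_ge0.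
  over.
have mI r :
    measurable_fun setT (fun x => (\1_(f @^-1` [set r]) (Z x))%:E : \bar R).
  apply/measurable_EFinP; apply: (measurableT_comp _ mZ) => //.
rewrite [RHS]ge0_integral_fsum//; last 2 first.
  - move=> r; apply: emeasurable_funM => //.
    by under eq_fun do rewrite EFinM; apply: emeasurable_funM => //.
  - by move=> r x _; rewrite mule_ge0// EFinM nnfun_muleindic_ge0.
apply: eq_fsbigr => r _; rewrite integralZl_indic_nnsfun//.
rewrite integral_density_indic//.
have [r0|r0] := ltP r 0%R.
  by rewrite preimage_nnfun0// !integral0_eq ?mule0// => x _;
     rewrite indic0 ?mulr0 mul0e.
rewrite -ge0_integralZl//.
- by apply: eq_integral => x _; rewrite EFinM muleA.
- exact: emeasurable_funM.
- by move=> x _; rewrite mule_ge0.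
Qed.

(** Proved for indicators, then simple functions, then by monotone limits. It serves with three
    weights: the normal density ([Z] the identity), the constant 1 (the law of a coordinate), and a
    product over the other coordinates (independence). *)
Lemma ge0_integral_density (f : T2 -> \bar R) :
  measurable_fun setT f -> (forall x, 0 <= f x) ->
  \int[nu]_x f x = \int[mu]_x (f (Z x) * (w x)%:E).
Proof.
move=> mf f0.
pose f_ := nnsfun_approx measurableT mf.
have cvf x : (f_ n x)%:E @[n --> \oo] --> f x by exact: cvg_nnsfun_approx.
have ndf x : nondecreasing_seq (fun n => (f_ n x)%:E).
  by move=> m n mn; rewrite lee_fin; exact/lefP/nd_nnsfun_approx.
transitivity (lim (\int[nu]_x (f_ n x)%:E @[n --> \oo])).
  rewrite -monotone_convergence//=.
  - by apply: eq_integral => x _; apply/esym/cvg_lim.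
  - by move=> n; exact/measurable_EFinP/measurable_funTS.
  - by move=> n ? _; rewrite lee_fin.
transitivity (lim (\int[mu]_x ((f_ n (Z x))%:E * (w x)%:E) @[n --> \oo])).
  by apply: congr_lim; apply/funext => n; exact: integral_density_nnsfun.
rewrite -monotone_convergence//=.
- apply: eq_integral => x _; apply/cvg_lim => //.
  by apply: cvgeZr => //; exact: cvf.
- move=> n; apply: emeasurable_funM => //.
  by apply/measurable_EFinP; exact: measurableT_comp.
- by move=> n x _; rewrite mule_ge0// lee_fin.
- by move=> x _ m n mn; rewrite lee_wpmul2r//; exact: ndf.
Qed.

End ChangeOfVariables.

(** * Exponential moments of one normal variable *)

Section NormalMoments.
Context {R : realType}.
Implicit Types v s rho : R.

Lemma ge0_integral_normal_prob m s (f : R -> R) :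
  measurable_fun setT f -> (forall x, 0 <= f x) ->
  (\int[normal_prob m s]_x (f x)%:E
   = \int[lebesgue_measure]_x (f x * normal_pdf m s x)%:E)%E.
Proof.
move=> mf f0.
rewrite (ge0_integral_density (mu := lebesgue_measure) (Z := id)
  (w := normal_pdf m s))//.
- exact: measurable_normal_pdf.
- exact: normal_pdf_ge0.
- exact/measurable_EFinP.
Qed.

(** Completing the square: the tilted density is a constant times the normal density with mean
    [s ^+ 2 * v]. *)
Lemma normal_prob_expR v s : 0 < s ->
  (\int[normal_prob 0 s]_x (expR (v * x))%:E
   = (expR (s ^+ 2 * v ^+ 2 / 2))%:E)%E.
Proof.
move=> s0; rewrite ge0_integral_normal_prob//; last first.
  by apply: measurableT_comp => //; exact: measurable_funM.
have sN0 : s != 0 by rewrite gt_eqF.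
under eq_integral => x _.
  rewrite (_ : _ * _ =
    expR (s ^+ 2 * v ^+ 2 / 2) * normal_pdf (s ^+ 2 * v) s x).
    rewrite EFinM; over.
  rewrite !normal_pdfE// /normal_fun mulrCA [RHS]mulrCA -!expRD.
  congr (_ * expR _).
  by rewrite -mulr_natr; field.
rewrite ge0_integralZl//.
- by rewrite integral_normal_pdf mule1.
- by apply/measurable_EFinP; exact: measurable_normal_pdf.
- by move=> x _; rewrite lee_fin normal_pdf_ge0.
Qed.

(** The tilt leaves the exponent [- rho ^+ 2 * x ^+ 2 / 2], so the integrand is [rho^-1] times the
    centred normal density of standard deviation [rho^-1]. *)
Lemma normal_prob_expR_sqr rho : 0 < rho ->
  (\int[normal_prob 0 1]_x (expR ((1 - rho ^+ 2) / 2 * x ^+ 2))%:E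
   = (rho^-1)%:E)%E.
Proof.
move=> r0; rewrite ge0_integral_normal_prob//; last first.
  by apply: measurableT_comp => //; apply: measurable_funM => //.
have rN0 : rho != 0 by rewrite gt_eqF.
under eq_integral => x _.
  rewrite (_ : _ * _ = rho^-1 * normal_pdf 0 rho^-1 x).
    rewrite EFinM; over.
  rewrite !normal_pdfE ?oner_eq0 ?invr_eq0// /normal_fun mulrCA -expRD.
  have -> : normal_peak 1 = rho^-1 * normal_peak (rho^-1).
    rewrite /normal_peak expr1n mul1r -mulrnAr sqrtrM ?sqr_ge0// sqrtr_sqr.
    by rewrite gtr0_norm ?invr_gt0// invfM invrK mulrA mulVf// mul1r.
  rewrite -[LHS]mulrA; congr (_ * (_ * expR _)).
  by rewrite -[_ *+ 2]mulr_natr -[in RHS]mulr_natr; field.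
rewrite ge0_integralZl//.
- by rewrite integral_normal_pdf mule1.
- by apply/measurable_EFinP; exact: measurable_normal_pdf.
- by move=> x _; rewrite lee_fin normal_pdf_ge0.
- by rewrite lee_fin invr_ge0 ltW.
Qed.

End NormalMoments.

(** * Product rule for expectations of independent variables *)

Section Independence.
Context {d} {T : measurableType d} {R : realType} {P : probability T R}.
Context {I : finType} {Z : I -> {RV P >-> R}}.
Hypothesis indepZ : mutually_independent Z.

Let measurable_prod_comp (D : pred I) (f : I -> R -> R) :
  (forall i, measurable_fun setT (f i)) ->
  measurable_fun setT (fun w => \prod_(i | D i) f i (Z i w)).
Proof.
move=> mf; under eq_fun do rewrite -big_filter.
by apply: measurable_prod => i _; exact: measurableT_comp.
Qed.

Let integral_prod_indic (A : I -> set R) : (forall i, measurable (A i)) ->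
  (\int[P]_w (\prod_i \1_(A i) (Z i w))%:E = \prod_i P (Z i @^-1` A i))%E.
Proof.
move=> mA; have := indepZ (setTfor I) mA.
under [X in _ = X -> _]eq_bigl do rewrite inE.
move=> <-; rewrite -[in RHS](setIT (\bigcap_(_ in _) _)).
rewrite -integral_indic//; last first.
  apply: fin_bigcap_measurable => // i _.
  by rewrite -[_ @^-1` _]setTI; exact: measurable_funPT.
apply: eq_integral => w _; congr EFin.
rewrite [in RHS]indicE; case: (boolP (w \in _)) => [/set_mem wA|].
  rewrite big1// => i _; rewrite indicE mem_set//.
  by apply: wA => /=; rewrite inE.
move=> /negP wA; apply/eqP; rewrite prodf_seq_eq0; apply/hasP.
have [i Zi] : exists i, ~ A i (Z i w).
  apply/existsNP => ZA; apply: wA; apply/mem_set => i _; exact: ZA.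
exists i; first exact: mem_index_enum.
by rewrite indicE memNset//=.
Qed.

Lemma integral_prod_independent (f : I -> R -> R) (c : I -> R) :
  (forall i, measurable_fun setT (f i)) -> (forall i x, 0 <= f i x) ->
  (forall i, \int[P]_w (f i (Z i w))%:E = (c i)%:E)%E ->
  (\int[P]_w (\prod_i f i (Z i w))%:E = (\prod_i c i)%:E)%E.
Proof.
(* Indicators are replaced by arbitrary functions one coordinate at a time. *)
suff gen (s : seq I) (g : I -> R -> R) (b : I -> R) :
    (forall i, measurable_fun setT (g i)) -> (forall i x, 0 <= g i x) ->
    (forall i, \int[P]_w (g i (Z i w))%:E = (b i)%:E)%E ->
    (forall i, i \notin s -> exists2 A, measurable A & g i = \1_A) ->
    (\int[P]_w (\prod_i g i (Z i w))%:E = (\prod_i b i)%:E)%E.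
  move=> mf f0 cE; apply: (gen (enum I)) => // i; by rewrite mem_enum.
elim: s g b => [|i s IH] g b mg g0 bE gs.
  have /choice[A gA] : forall i, exists A, measurable A /\ g i = \1_A.
    by move=> i; have [//|A mA ->] := gs i; exists A.
  have mA i : measurable (A i) by have [] := gA i.
  have gE i : g i = \1_(A i) by have [] := gA i.
  under eq_integral do under eq_bigr do rewrite gE.
  rewrite integral_prod_indic// -prodEFin; apply: eq_bigr => i _.
  rewrite -bE gE.
  transitivity (\int[P]_w (\1_(Z i @^-1` A i) w)%:E)%E.
    rewrite integral_indic ?setIT//.
    by rewrite -[_ @^-1` _]setTI; exact: measurable_funPT.
  by apply: eq_integral => w _; rewrite !indicE; congr (_ _)%:E.
have b0 j : 0 <= b j.
  by rewrite -lee_fin -bE; apply: integral_ge0 => w _; rewrite lee_fin.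
pose W w := \prod_(j | j != i) g j (Z j w).
have W0 w : 0 <= W w by apply: prodr_ge0.
have C0 : 0 <= \prod_(j | j != i) b j by apply: prodr_ge0.
have mW : measurable_fun setT W by exact: measurable_prod_comp.
(* [nu] is the image under [Z i] of [P] weighted by [W]: independence makes it a multiple of the law
   of [Z i], the factor being the expectation of [W]. *)
pose nu := mscale (NngNum C0) (distribution P (Z i)).
transitivity (\int[nu]_x (g i x)%:E)%E; last first.
  rewrite ge0_integral_mscale//=; last 2 first.
  - exact/measurable_EFinP.
  - by move=> x _; rewrite lee_fin.
  rewrite ge0_integral_distribution//=; last 2 first.
  - exact/measurable_EFinP.
  - by move=> x; rewrite lee_fin.
  by rewrite bE -EFinM [in RHS](bigD1 i)//= mulrC.
rewrite (ge0_integral_density (mu := P) (Z := Z i) (w := W))//.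
- by apply: eq_integral => w _; rewrite -EFinM (bigD1 i).
- move=> A mA; rewrite /nu/= /mscale/= /distribution /pushforward.
  (* With an indicator at [i], this index leaves the list and the induction hypothesis computes the
     integral of [W] over the event that [Z i] lies in [A]. *)
  pose g' j := if j == i then \1_A else g j.
  have mZA : measurable (Z i @^-1` A).
    by rewrite -[_ @^-1` _]setTI; exact: measurable_funPT.
  pose b' j := if j == i then fine (P (Z i @^-1` A)) else b j.
  have : (\int[P]_w (\prod_j g' j (Z j w))%:E = (\prod_j b' j)%:E)%E.
    apply: IH => [j|j x|j|j js].
    + by rewrite /g'; case: ifP.
    + by rewrite /g'; case: ifP => // _; rewrite indicE.
    + rewrite /g' /b'; case: eqP => [->|//].
      transitivity (\int[P]_w (\1_(Z i @^-1` A) w)%:E)%E.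
        by apply: eq_integral => w _; rewrite !indicE; congr (_ _)%:E.
      by rewrite integral_indic ?setIT// fineK ?fin_num_measure.
    + rewrite /g'; case: eqP => [_|/eqP ji]; first by exists A.
      by apply: gs; rewrite inE negb_or ji.
  rewrite (bigD1 i)//= {1}/b' eqxx (eq_bigr b); last first.
    by move=> j /negbTE ji; rewrite /b' ji.
  rewrite mulrC EFinM fineK ?fin_num_measure// => <-.
  rewrite [RHS]integral_mkcond; apply: eq_integral => w _.
  rewrite (bigD1 i)//= {1}/g' eqxx patchE indicE.
  rewrite (eq_bigr (fun j => g j (Z j w))); last first.
    by move=> j /negbTE ji; rewrite /g' ji.
  have -> : (w \in Z i @^-1` A) = (Z i w \in A) by apply/idP/idP; rewrite !inE.
  by case: ifP; rewrite ?mul1r ?mul0r.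
- exact/measurable_EFinP.
- by move=> x; rewrite lee_fin.
Qed.

End Independence.

(** * Euclidean dot product and orthogonal projectors *)

Section DotProduct.
Context {R : realType} {n : nat}.
Implicit Types (u v w : 'cV[R]_n) (Q : 'M[R]_n).

Definition dot u v : R := (u^T *m v) 0 0.

Lemma dotE u v : dot u v = \sum_i u i 0 * v i 0.
Proof. by rewrite /dot mxE; apply: eq_bigr => i _; rewrite mxE. Qed.

Lemma dotC u v : dot u v = dot v u.
Proof. by rewrite !dotE; apply: eq_bigr => i _; rewrite mulrC. Qed.

Lemma dotDr u v w : dot u (v + w) = dot u v + dot u w.
Proof. by rewrite /dot mulmxDr mxE. Qed.

Lemma dotZr a u v : dot u (a *: v) = a * dot u v.
Proof. by rewrite /dot -scalemxAr mxE. Qed.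

Lemma dotDl u v w : dot (v + w) u = dot v u + dot w u.
Proof. by rewrite dotC dotDr !(dotC u). Qed.

Lemma dotZl a u v : dot (a *: u) v = a * dot u v.
Proof. by rewrite dotC dotZr dotC. Qed.

Lemma dotNr u v : dot u (- v) = - dot u v.
Proof. by rewrite -scaleN1r dotZr mulN1r. Qed.

Lemma dotNl u v : dot (- u) v = - dot u v.
Proof. by rewrite dotC dotNr dotC. Qed.

Lemma dot_mulmxl Q u v : dot (Q *m u) v = dot u (Q^T *m v).
Proof. by rewrite /dot trmx_mul mulmxA. Qed.

Lemma sqnormE v : sqnorm v = dot v v.
Proof. by rewrite dotE; apply: eq_bigr => i _; rewrite expr2. Qed.

Lemma sqnorm_ge0 v : 0 <= sqnorm v.
Proof. by apply: sumr_ge0 => i _; exact: sqr_ge0. Qed.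

Lemma sqnorm_eq0 v : (sqnorm v == 0) = (v == 0).
Proof.
rewrite /sqnorm psumr_eq0 => [|i _]; last exact: sqr_ge0.
apply/allP/eqP => [v0|-> i _]; last by rewrite /= mxE expr0n eqxx.
apply/matrixP => i j; rewrite ord1 [RHS]mxE.
by have := v0 i (mem_index_enum i); rewrite /= sqrf_eq0 => /eqP.
Qed.

End DotProduct.

Definition orth_projector {R : realType} {n : nat} (Q : 'M[R]_n) : Prop :=
  Q^T = Q /\ Q *m Q = Q.

Section OrthProjectors.
Context {R : realType} {n : nat}.
Implicit Types (u v w : 'cV[R]_n) (Q : 'M[R]_n).

Lemma dot_projector Q u v : orth_projector Q ->
  dot (Q *m u) (Q *m v) = dot u (Q *m v).
Proof. by move=> [sQ QQ]; rewrite dot_mulmxl sQ mulmxA QQ. Qed.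

Lemma dot_projector_ge0 Q v : orth_projector Q -> 0 <= dot v (Q *m v).
Proof. by move=> pQ; rewrite -dot_projector// -sqnormE sqnorm_ge0. Qed.

(** Splits off one dimension, for induction on the rank. Any nonzero column of [Q], once normalised,
    is fixed by [Q] since [Q] is idempotent. *)
Lemma projector_deflation Q : orth_projector Q -> Q != 0 ->
  exists u, [/\ sqnorm u = 1, Q *m u = u, orth_projector (Q - u *m u^T)
    & (\rank (Q - u *m u^T)%R < \rank Q)%N].
Proof.
move=> [sQ QQ] Q0.
have [j cj0] : exists j, col j Q != 0.
  apply/existsP; apply: contraNT Q0; rewrite negb_exists => /forallP c0.
  apply/eqP/matrixP => i j; have := c0 j; rewrite negbK => /eqP/matrixP/(_ i 0).
  by rewrite !mxE.
have n0 : 0 < sqnorm (col j Q) by rewrite lt_def sqnorm_eq0 cj0 sqnorm_ge0.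
pose u := (Num.sqrt (sqnorm (col j Q)))^-1 *: col j Q.
have Qu : Q *m u = u by rewrite /u -scalemxAr colE mulmxA QQ.
have nu : sqnorm u = 1.
  rewrite sqnormE dotZl dotZr mulrA -sqnormE -invfM -expr2 sqr_sqrtr ?ltW//.
  by rewrite mulVf// gt_eqF.
have uTu : u^T *m u = 1%:M.
  by rewrite [LHS]mx11_scalar -[_ 0 0]/(dot u u) -sqnormE nu.
have uQ : u^T *m Q = u^T by rewrite -[Q]sQ -trmx_mul Qu.
have Q'Q' : (Q - u *m u^T) *m (Q - u *m u^T) = Q - u *m u^T.
  rewrite mulmxBl !mulmxBr QQ mulmxA Qu -!(mulmxA u) uQ (mulmxA u^T) uTu mul1mx.
  by rewrite subrr subr0.
exists u; split => //.
  by split => //; rewrite linearB/= trmx_mul trmxK sQ.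
have Q'Q : ((Q - u *m u^T)%R <= Q)%MS.
  apply/submxP; exists (Q - u *m u^T).
  by rewrite mulmxBl QQ -mulmxA uQ.
have : ((Q - u *m u^T)%R < Q)%MS.
  rewrite ltmxE Q'Q/=; apply/negP => QQ'.
  (* If the row spaces agreed, [u^T] would be a multiple of the deflated projector, which kills [u];
     this would force [u^T *m u = 0]. *)
  have /submxP[a uE] : (u^T <= (Q - u *m u^T)%R)%MS.
    by rewrite (submx_trans _ QQ')// -uQ submxMl.
  have : u^T *m u = 0.
    by rewrite uE -mulmxA mulmxBl Qu -mulmxA uTu mulmx1 subrr mulmx0.
  move=> /(congr1 (fun A : 'M[R]_1 => A 0 0)).
  by rewrite -[LHS]/(dot u u) -sqnormE nu mxE => /eqP; rewrite oner_eq0.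
by rewrite ltmxErank => /andP[].
Qed.

End OrthProjectors.

(** * Exponential moments of the Gaussian noise vector *)

Section GaussianNoiseMoments.
Context {d} {T : measurableType d} {R : realType} {P : probability T R}.
Context {n : nat} {sigma : R} {eps : 'I_n -> {RV P >-> R}}.
Hypothesis sigma0 : 0 < sigma.
Hypothesis gauss : gaussian_noise sigma eps.

Local Notation e w := (\col_i eps i w : 'cV[R]_n).
Implicit Types (u v : 'cV[R]_n) (Q : 'M[R]_n).

Lemma measurable_dot_noise v : measurable_fun setT (fun w => dot v (e w)).
Proof.
under eq_fun do rewrite dotE.
apply: measurable_sum => i; apply: measurable_funM => //.
by under eq_fun do rewrite mxE; exact: measurable_funPT.
Qed.

Lemma measurable_quad_noise Q :
  measurable_fun setT (fun w => dot (e w) (Q *m e w)).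
Proof.
under eq_fun do rewrite dotE.
apply: measurable_sum => i; apply: measurable_funM.
  by under eq_fun do rewrite mxE; exact: measurable_funPT.
under eq_fun do rewrite mxE.
apply: measurable_sum => j; apply: measurable_funM => //.
by under eq_fun do rewrite mxE; exact: measurable_funPT.
Qed.

Lemma integral_expR_dot_noise v :
  (\int[P]_w (expR (dot v (e w)))%:E = (expR (sigma ^+ 2 * sqnorm v / 2))%:E)%E.
Proof.
have [law indep] := gauss.
transitivity (\int[P]_w (\prod_i expR (v i 0 * eps i w))%:E)%E.
  apply: eq_integral => w _; rewrite -expR_sum dotE; congr (expR _)%:E.
  by apply: eq_bigr => i _; rewrite mxE.
rewrite (integral_prod_independent indep (f := fun i x => expR (v i 0 * x))
  (c := fun i => expR (sigma ^+ 2 * v i 0 ^+ 2 / 2))).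
- rewrite -expR_sum; congr (expR _)%:E.
  by rewrite -mulr_suml -mulr_sumr.
- by move=> i; apply: measurableT_comp => //; exact: measurable_funM.
- by move=> i x; exact: expR_ge0.
- move=> i; rewrite -normal_prob_expR//.
  have meps : measurable_fun setT (eps i) by exact: measurable_funPT.
  rewrite (ge0_integral_density (T2 := measurableTypeR R) (mu := P)
    (nu := normal_prob 0 sigma) (Z := eps i) (w := cst 1))//.
  - by apply: eq_integral => w _; rewrite mule1.
  - move=> A mA; transitivity (distribution P (eps i) A); first exact/esym/law.
    rewrite (integral_cst _ _ 1) ?mul1e//.
    by rewrite -[_ @^-1` _]setTI; exact: measurable_funPT.
  - by apply/measurable_EFinP; apply: measurableT_comp => //;
      exact: measurable_funM.
Qed.

Section QuadraticMoment.
Variables (kappa rho : R).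
Hypothesis rho0 : 0 < rho.
Hypothesis rhoE : rho ^+ 2 + sigma ^+ 2 * kappa ^+ 2 = 1.

Let rho_le1 : rho <= 1.
Proof.
have [//|r1] := leP rho 1.
have : 1 < rho ^+ 2 by rewrite exprn_egt1.
by rewrite -[X in X < _]rhoE gtrDl ltNge mulr_ge0 ?sqr_ge0.
Qed.

(** Induction on the rank bound: each dimension in the range of [Q] costs a factor
    [(1 - sigma^2 kappa^2)^(-1/2)], which is [rho^-1] by [rhoE]. The condition [Q *m v = 0] keeps
    the linear part orthogonal to the quadratic one. *)
Lemma integral_expR_quad_noise k Q v :
  orth_projector Q -> Q *m v = 0 -> (\rank Q <= k)%N ->
  (\int[P]_w (expR (dot v (e w) + kappa ^+ 2 / 2 * dot (e w) (Q *m e w)))%:E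
   <= (rho ^- k * expR (sigma ^+ 2 * sqnorm v / 2))%:E)%E.
Proof.
elim: k Q v => [|k IH] Q v pQ Qv rQ.
  have -> : Q = 0 by apply/eqP; rewrite -mxrank_eq0 -leqn0.
  rewrite expr0 invr1 mul1r -integral_expR_dot_noise le_eqVlt; apply/orP; left.
  apply/eqP/eq_integral => w _.
  by rewrite mul0mx /dot mulmx0 [X in _ * X]mxE mulr0 addr0.
(* The rank may be smaller than the bound; the spare factors [rho^-1] are at least 1. *)
have [->|Q0] := eqVneq Q 0.
  under eq_integral do
    rewrite mul0mx /dot mulmx0 [X in _ * X]mxE mulr0 addr0
      -[(_ *m _) 0 0]/(dot _ _).
  rewrite integral_expR_dot_noise lee_fin ler_peMl ?expR_ge0//.
  by rewrite invf_ge1 ?exprn_gt0// exprn_ile1// ltW.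
have [u [u1 Qu pQ' rQ']] := projector_deflation pQ Q0.
set Q' := Q - u *m u^T in pQ' rQ'.
have uv : dot u v = 0.
  by rewrite -Qu dot_mulmxl; case: pQ => -> _; rewrite Qv /dot mulmx0 mxE.
(* For each fixed value [g] of the auxiliary variable, the shifted linear part satisfies the
   induction hypothesis for [Q']. *)
have Q'u g : Q' *m (v + (kappa * g) *: u) = 0.
  have uu : u^T *m u = 1%:M.
    by rewrite [LHS]mx11_scalar -[_ 0 0]/(dot u u) -sqnormE u1.
  have uv0 : u^T *m v = 0.
    by rewrite [LHS]mx11_scalar -[_ 0 0]/(dot u v) uv raddf0.
  rewrite /Q' mulmxBl !mulmxDr -!scalemxAr Qv Qu -!mulmxA uv0 uu mulmx0 mulmx1.
  by rewrite subrr.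
have QQ' w : dot (e w) (Q *m e w) = dot (e w) (Q' *m e w) + dot u (e w) ^+ 2.
  rewrite /Q' mulmxBl dotDr dotNr -mulmxA.
  rewrite [u^T *m _]mx11_scalar -[_ 0 0]/(dot u (e w)) mul_mx_scalar dotZr.
  by rewrite (dotC _ u) -expr2 subrK.
pose F (x : T * R) := expR (dot (v + (kappa * x.2) *: u) (e x.1)
  + kappa ^+ 2 / 2 * dot (e x.1) (Q' *m e x.1)).
have mF : measurable_fun setT F.
  apply: measurableT_comp => //; apply: measurable_funD.
    under eq_fun do rewrite dotDl dotZl.
    apply: measurable_funD.
      exact: (measurableT_comp (measurable_dot_noise v)).
    apply: measurable_funM; first exact: measurable_funM.
    exact: (measurableT_comp (measurable_dot_noise u)).
  apply: measurable_funM => //.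
  exact: (measurableT_comp (measurable_quad_noise Q')).
have F0 x : 0 <= F x by exact: expR_ge0.
(* Hubbard-Stratonovich: the square along [u] is linearised by averaging over
   an auxiliary standard Gaussian variable. *)
have HS w : (expR (dot v (e w) + kappa ^+ 2 / 2 * dot (e w) (Q *m e w)))%:E
    = (\int[normal_prob 0 1]_g (F (w, g))%:E)%E.
  transitivity (\int[normal_prob 0%R 1%R]_g
     ((expR (dot v (e w) + kappa ^+ 2 / 2 * dot (e w) (Q' *m e w)))%:E
      * (expR (kappa * dot u (e w) * g))%:E))%E; last first.
    apply: eq_integral => g _; rewrite /F -EFinM -expRD dotDl dotZl /=.
    by congr (expR _)%:E; ring.
  rewrite ge0_integralZl//.
  - rewrite normal_prob_expR// -EFinM -expRD QQ'; congr (expR _)%:E; ring.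
  - by apply/measurable_EFinP; apply: measurableT_comp => //;
      exact: measurable_funM.
under eq_integral do rewrite HS.
have mEF : measurable_fun setT (fun x => (F x)%:E) by exact/measurable_EFinP.
rewrite (fubini_tonelli (m1 := P) (m2 := normal_prob 0 1)
  (fun x => (F x)%:E))//.
(* The extra factor [rho^-1] of the target is written as a standard normal average over [g], so that
   it suffices to compare integrands at each [g]. *)
have -> : (rho ^- k.+1 * expR (sigma ^+ 2 * sqnorm v / 2))%:E =
  (\int[normal_prob 0%R 1%R]_g
    ((rho ^- k * expR (sigma ^+ 2 * sqnorm v / 2))%:E *
      (expR ((1 - rho ^+ 2) / 2 * g ^+ 2))%:E))%E.
  rewrite ge0_integralZl//.
  - rewrite normal_prob_expR_sqr// -EFinM; congr _%:E.
    by rewrite exprS invfM; ring.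
  - by apply/measurable_EFinP; apply: measurableT_comp => //;
      exact: measurable_funM.
  - by rewrite lee_fin mulr_ge0 ?expR_ge0// invr_ge0 exprn_ge0// ltW.
apply: ge0_le_integral_nonmeasurable => [g|g].
  by apply: integral_ge0 => w _; rewrite lee_fin.
apply: le_trans (IH Q' (v + (kappa * g) *: u) pQ' (Q'u g) _) _.
  by rewrite -ltnS (leq_trans rQ').
rewrite -EFinM lee_fin -[leRHS]mulrA -expRD.
(* Pythagoras, since [u] is a unit vector orthogonal to [v], with [rhoE] giving the coefficient of
   [g ^+ 2]. *)
rewrite (_ : _ / 2 = sigma ^+ 2 * sqnorm v / 2 + (1 - rho ^+ 2) / 2 * g ^+ 2)//.
rewrite -rhoE !sqnormE dotDl !dotDr !dotZl !dotZr (dotC v u) uv -!sqnormE u1.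
by ring.
Qed.

End QuadraticMoment.

End GaussianNoiseMoments.

(** * Projectors on column spans and on models *)

Section SpanProjector.
Context {R : realType} {n : nat}.

(** The hat matrix of [Z], for [Z] of any rank. *)
Definition span_projector {p} (Z : 'M[R]_(n, p)) : 'M[R]_n :=
  Z *m mpinv (Z^T *m Z) *m Z^T.

Lemma trmx_span_projector p (Z : 'M[R]_(n, p)) :
  Z^T *m span_projector Z = Z^T.
Proof. by rewrite /span_projector !mulmxA gram_mpinv. Qed.

(** Since [Q^T] fixes [Z], one gets [Q^T *m Q = Q]; this gives symmetry first and then
    idempotence. *)
Lemma span_projectorP p (Z : 'M[R]_(n, p)) : orth_projector (span_projector Z).
Proof.
have ZQ := trmx_span_projector Z; set Q := span_projector Z in ZQ *.
have QZ : Q^T *m Z = Z by apply: trmx_inj; rewrite trmx_mul trmxK ZQ.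
have QQ : Q^T *m Q = Q by rewrite {2}/Q /span_projector !mulmxA QZ.
have sQ : Q^T = Q by rewrite -{1}QQ trmx_mul trmxK QQ.
by split; rewrite // -{1}sQ.
Qed.

Lemma span_projector_id p (Z : 'M[R]_(n, p)) : span_projector Z *m Z = Z.
Proof.
have [sQ _] := span_projectorP Z.
by apply: trmx_inj; rewrite trmx_mul sQ trmx_span_projector.
Qed.

Lemma rank_span_projector p (Z : 'M[R]_(n, p)) :
  (\rank (span_projector Z) <= \rank Z)%N.
Proof. by rewrite /span_projector -mulmxA mxrankM_maxl. Qed.

(** Each projector absorbs the other on its right; transposing one of the two identities shows that
    they coincide. *)
Lemma eq_span_projector p q (Z : 'M[R]_(n, p)) (Z' : 'M[R]_(n, q)) :
  (Z^T <= Z'^T)%MS -> (Z'^T <= Z^T)%MS -> span_projector Z = span_projector Z'.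
Proof.
have absorb p1 p2 (Y : 'M[R]_(n, p1)) (Y' : 'M[R]_(n, p2)) :
    (Y^T <= Y'^T)%MS ->
    span_projector Y' *m span_projector Y = span_projector Y.
  move=> /submxP[A /(congr1 trmx)]; rewrite trmxK trmx_mul trmxK => YE.
  have QY : span_projector Y' *m Y = Y by rewrite YE mulmxA span_projector_id.
  by rewrite [span_projector Y]/span_projector !mulmxA QY.
move=> /absorb ZZ' /absorb Z'Z.
have [sZ _] := span_projectorP Z; have [sZ' _] := span_projectorP Z'.
by have := congr1 trmx ZZ'; rewrite trmx_mul sZ sZ' Z'Z.
Qed.

Lemma orthproj_span_projector p (Z : 'M[R]_(n, p)) v :
  orthproj Z v = span_projector Z *m v.
Proof.
apply: (orthprojE (a := mpinv (Z^T *m Z) *m Z^T *m v)).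
  by rewrite /span_projector !mulmxA.
by rewrite mulmxBr mulmxA trmx_span_projector subrr.
Qed.

End SpanProjector.

Section ModelProjector.
Context {R : realType} {n p : nat}.
Implicit Types (X : 'M[R]_(n, p)) (M : {set 'I_p}).

Definition model_projector X M : 'M[R]_n := span_projector (X *m sel_mx M).

Lemma model_projectorP X M : orth_projector (model_projector X M).
Proof. exact: span_projectorP. Qed.

Lemma model_projE X M v : model_proj X M v = model_projector X M *m v.
Proof. exact: orthproj_span_projector. Qed.

Let row_model X M i :
  row i (X *m sel_mx M)^T = (i \in M)%:R *: row i X^T.
Proof.
apply/rowP => j; rewrite !mxE (bigD1 i)//= big1 => [|k ki]; rewrite !mxE ?eqxx.
  by rewrite mulr1n addr0 mulrC.
by rewrite (negbTE ki) mulr0n mulr0.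
Qed.

(** Only the columns of [X] in [M] survive the selection. *)
Lemma rank_model_projector X M : (\rank (model_projector X M) <= #|M|)%N.
Proof.
apply: leq_trans (rank_span_projector _) _; rewrite -mxrank_tr.
apply: leq_trans (rank_leq_row (rowsub (enum_val : 'I_#|M| -> _) X^T)).
apply/mxrankS/row_subP => i; rewrite row_model.
have [iM|_] := boolP (i \in M); last by rewrite scale0r sub0mx.
rewrite scale1r -(enum_rankK_in iM iM) -row_rowsub.
exact: row_sub.
Qed.

(** A set of [\rank X] independent columns already spans the column space of [X]. This justifies
    treating all models of that size as one. *)
Lemma saturated_model_projector X M :
  (forall f : 'I_(\rank X) -> 'I_p, injective f -> row_free (colsub f X)^T) ->
  #|M| = \rank X -> model_projector X M = span_projector X.
Proof.
move=> hX cM; set Z := X *m sel_mx M.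
have ZX : (Z^T <= X^T)%MS by rewrite trmx_mul submxMl.
apply: eq_span_projector => //.
rewrite -(mxrank_leqif_sup ZX).
rewrite eqn_leq mxrankS//= mxrank_tr.
pose f (i : 'I_(\rank X)) := enum_val (cast_ord (esym cM) i).
have fM i : f i \in M by exact: enum_valP.
have finj : injective f by move=> i j /enum_val_inj/cast_ord_inj.
have /eqP <- := hX f finj; apply: mxrankS; apply/row_subP => i.
rewrite (_ : row i _ = row (f i) Z^T) ?row_sub// row_model fM scale1r.
by apply/rowP => j; rewrite !mxE.
Qed.

End ModelProjector.

(** Follows from [1 + s * x <= expR (s * x)]; it replaces a signed variable by a nonnegative one. *)
Lemma ler_expR_scaled {R : realType} (s x : R) :
  0 < s -> x <= s^-1 * expR (s * x).
Proof.
move=> s0; rewrite -ler_pdivrMl ?invr_gt0// invrK.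
by apply: le_trans (expR_ge1Dx _); rewrite lerDr.
Qed.

(** Expand both residuals: [sqnorm e] cancels, and the fixed model leaves [- dot e (Q *m e)], which
    [q0] discards. The share [th] of the risk moved to the right splits by Pythagoras into a bias
    part and a noise part. *)
Lemma selection_risk_bound {R : realType} {n : nat} (Q Qh : 'M[R]_n)
    (mu e : 'cV[R]_n) (pen penh th : R) :
  orth_projector Q -> orth_projector Qh ->
  sqnorm (mu + e - Qh *m (mu + e)) + penh
    <= sqnorm (mu + e - Q *m (mu + e)) + pen ->
  (1 - th) * sqnorm (Qh *m (mu + e) - mu)
    <= sqnorm (Q *m mu - mu) + pen + 2 * dot (mu - Q *m mu) e
       + ((2 - th) * dot e (Qh *m e) + 2 * dot (Qh *m mu - mu) e
          - th * sqnorm (Qh *m mu - mu) - penh).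
Proof.
move=> pQ pQh; have q0 := dot_projector_ge0 e pQ.
have sym (Q' : 'M[R]_n) u v :
    orth_projector Q' -> dot v (Q' *m u) = dot u (Q' *m v).
  by move=> [sQ _]; rewrite dotC dot_mulmxl sQ.
rewrite !sqnormE !mulmxDr !(dotDl, dotDr, dotNl, dotNr).
rewrite !(dot_projector _ _ pQ) !(dot_projector _ _ pQh).
rewrite !(dotC (_ *m _) mu) !(dotC (_ *m _) e).
rewrite (sym Q e mu)// (sym Qh e mu)// (dotC e mu).
by lra.
Qed.

(** * The penalty against the prior *)

Section PriorBounds.
Context {R : realType}.
Variables (gamma sigma : R) (p r : nat) (prior : nat -> R).
Hypothesis gamma0 : 0 < gamma.
Hypothesis sigma0 : 0 < sigma.
Hypothesis r_le_p : (r <= p)%N.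
Hypothesis prior0 : forall k, (k <= r)%N -> 0 < prior k.
Let c := 8 * (gamma + 3 / 4) ^+ 2.
Hypothesis prior_lt : forall k, (k < r)%N ->
  prior k <= 'C(p, k)%:R * expR (- (c * k%:R)).
Hypothesis prior_r : prior r <= expR (- (c * r%:R)).

Let mult k : R := if (k < r)%N then 'C(p, k)%:R else 1.

Lemma model_count_gt0 k : (k <= r)%N -> 0 < ('C(p, k)%:R : R).
Proof. by move=> kr; rewrite ltr0n bin_gt0 (leq_trans kr). Qed.

Let mult_gt0 k : (k <= r)%N -> 0 < mult k.
Proof.
by move=> kr; rewrite /mult; case: ifP => // _; exact: model_count_gt0.
Qed.

(** Both prior assumptions, for [k < r] and for [k = r], in one logarithmic form. *)
Let ln_ratio_ge k : (k <= r)%N -> c * k%:R <= ln (mult k * (prior k)^-1).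
Proof.
move=> kr; have p0 := prior0 kr; have m0 := mult_gt0 kr.
rewrite -ler_expR lnK ?posrE ?divr_gt0// ler_pdivlMr//.
rewrite -ler_pdivlMl ?expR_gt0// -expRN mulrC /mult.
by move: kr; rewrite leq_eqVlt => /predU1P[->|kr];
  rewrite ?ltnn ?mul1r// kr prior_lt.
Qed.

Let c_ge0 : 0 <= c. Proof. by rewrite /c mulr_ge0// sqr_ge0. Qed.

Let ln_pen_ge k : (k <= r)%N -> ln (mult k * (prior k)^-1)
  <= ln (mult k * (prior k)^-1 * (1 + gamma) `^ (k%:R / 2)).
Proof.
move=> kr; have x0 : 0 < mult k / prior k by rewrite divr_gt0 ?mult_gt0 ?prior0.
have g1 : 1 <= (1 + gamma) `^ (k%:R / 2).
  by rewrite -[leLHS](powRr0 (1 + gamma)); apply: ler_powR;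
    rewrite ?divr_ge0// lerDl ltW.
have xg : mult k / prior k <= mult k / prior k * (1 + gamma) `^ (k%:R / 2).
  by rewrite ler_peMr// ltW.
by rewrite ler_ln ?posrE// (lt_le_trans x0).
Qed.

Let pen := penalty (p := p) gamma sigma r prior.

Lemma penalty_ge0 k : (k <= r)%N -> 0 <= pen k.
Proof.
move=> kr; rewrite /pen /penalty -/(mult k).
have a0 : 0 <= 1 + gamma^-1 by rewrite addr_ge0// invr_ge0 ltW.
apply: mulr_ge0; first by rewrite mulr_ge0// mulr_ge0// sqr_ge0.
apply: le_trans (ln_pen_ge kr); apply: le_trans (ln_ratio_ge kr).
by rewrite mulr_ge0.
Qed.

Let rho : R := (2 * (1 + gamma))^-1.

(** The exponent is [1 + (2 * gamma)^-1] times the logarithm [L'] in the penalty, and [L'] is at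
    least [L]. One copy of [L] produces the right-hand side; the fraction [(2 * gamma)^-1] of it
    pays for [rho ^- k]. *)
Lemma expR_penalty_le k : (k <= r)%N ->
  rho ^- k * expR (- ((1 - rho) / (2 * sigma ^+ 2) * pen k))
    <= (mult k)^-1 * prior k.
Proof.
move=> kr; have p0 := prior0 kr; have m0 := mult_gt0 kr.
have s0 : sigma != 0 by rewrite gt_eqF.
have g0 : gamma != 0 by rewrite gt_eqF.
have g10 : 1 + gamma != 0 by rewrite gt_eqF// addr_gt0.
have -> : (1 - rho) / (2 * sigma ^+ 2) * pen k = (1 + (2 * gamma)^-1) *
    ln (mult k * (prior k)^-1 * (1 + gamma) `^ (k%:R / 2)).
  by rewrite /pen /penalty -/(mult k) /rho; move: (ln _) => l;
    field; rewrite s0 g0 g10.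
have /= LL := ln_pen_ge kr; have Lc := ln_ratio_ge kr.
set L := ln (mult k * _) in LL Lc; set L' := ln _ in LL *.
have -> : (mult k)^-1 * prior k = expR (- L).
  by rewrite expRN lnK ?posrE ?divr_gt0// invfM invrK.
have rk : rho ^- k <= expR ((1 + 2 * gamma) * k%:R).
  rewrite /rho exprVn invrK expRM_natr.
  have r1 : 2 * (1 + gamma) <= expR (1 + 2 * gamma).
    by apply: le_trans (expR_ge1Dx _); lra.
  have r0 : 0 <= 2 * (1 + gamma) by rewrite mulr_ge0// addr_ge0// ltW.
  exact: lerXn2r (r0) (le_trans r0 r1) r1.
apply: le_trans (ler_wpM2r (expR_ge0 _) rk) _.
rewrite -expRD ler_expR.
(* The size of [c] enters here, through [2 * gamma * (1 + 2 * gamma) <= 8 * (gamma + 3 / 4) ^+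
   2]. *)
have kc : (1 + 2 * gamma) * k%:R <= (2 * gamma)^-1 * (c * k%:R).
  by rewrite mulrA ler_wpM2r// ler_pdivlMl ?mulr_gt0// /c;
    have := sqr_ge0 gamma; move: gamma0; lra.
have a0 : 0 <= (2 * gamma)^-1 by rewrite invr_ge0 mulr_ge0// ltW.
nra.
Qed.

(* All sets of [r] predictors are one saturated model, so each of them gets the
   weight ['C(p, r)^-1]; smaller models have weight 1. *)
Definition model_weight k : R := mult k / 'C(p, k)%:R.

Lemma model_weight_ge0 k : (k <= r)%N -> 0 <= model_weight k.
Proof. by move=> kr; rewrite divr_ge0 ?ltW ?mult_gt0 ?model_count_gt0. Qed.

(** Each term is at most the mass of one set when [prior k] is spread evenly over the sets of size
    [k]. *)
Lemma sum_penalty_weights : \sum_(k < r.+1) prior k = 1 ->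
  \sum_(M : {set 'I_p} | (#|M| <= r)%N) model_weight #|M| *
    (rho ^- #|M| * expR (- ((1 - rho) / (2 * sigma ^+ 2) * pen #|M|))) <= 1.
Proof.
move=> prior1; rewrite -[leRHS]prior1.
apply: (@le_trans _ _
  (\sum_(M : {set 'I_p} | (#|M| <= r)%N) prior #|M| / 'C(p, #|M|)%:R)).
  apply: ler_sum => M Mr.
  apply: le_trans (ler_wpM2l (model_weight_ge0 Mr) (expR_penalty_le Mr)) _.
  have m0 : mult #|M| != 0 by rewrite gt_eqF ?mult_gt0.
  have b0 : ('C(p, #|M|)%:R : R) != 0 by rewrite gt_eqF ?model_count_gt0.
  rewrite /model_weight le_eqVlt; apply/orP; left; apply/eqP.
  by move: b0; move: ('C(p, _)%:R) => b b0; field; rewrite m0 b0.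
(* Group by size; [inord] does not reach its default value because [#|M| <= r]. *)
rewrite (partition_big (fun M : {set 'I_p} => inord #|M| : 'I_r.+1) predT)//=.
apply: ler_sum => k _.
rewrite (eq_bigl (fun M : {set 'I_p} =>
  M \in [set M : {set 'I_p} | #|M| == k]%SET)); last first.
  move=> M; rewrite inE; apply/andP/eqP => [[Mr /eqP <-]|Mk].
    by rewrite inordK.
  by rewrite Mk -ltnS ltn_ord; split=> //; apply/eqP/val_inj; rewrite /= inordK.
rewrite (eq_bigr (fun=> prior k / 'C(p, k)%:R)); last first.
  by move=> M; rewrite inE => /eqP ->.
have b0 : ('C(p, k)%:R : R) != 0 by rewrite gt_eqF ?model_count_gt0// -ltnS.
by rewrite sumr_const card_draws card_ord -[_ *+ _]mulr_natr divfK.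
Qed.

End PriorBounds.

(** * Upper bounds for integrals of nonnegative combinations *)

Section IntegralBounds.
Context d (T : measurableType d) (R : realType) (P : {measure set T -> \bar R}).
Implicit Types (f g : T -> R).

Lemma integralD_le f g a b :
  measurable_fun setT f -> (forall w, 0 <= f w) ->
  measurable_fun setT g -> (forall w, 0 <= g w) ->
  (\int[P]_w (f w)%:E <= a%:E)%E -> (\int[P]_w (g w)%:E <= b%:E)%E ->
  (\int[P]_w (f w + g w)%:E <= (a + b)%:E)%E.
Proof.
move=> mf f0 mg g0 fa gb; under eq_integral do rewrite EFinD.
rewrite ge0_integralD//; first by rewrite EFinD leeD.
- by move=> w _; rewrite lee_fin.
- exact/measurable_EFinP.
- by move=> w _; rewrite lee_fin.
- exact/measurable_EFinP.
Qed.

Lemma integralZ_le f k a : 0 <= k ->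
  measurable_fun setT f -> (forall w, 0 <= f w) ->
  (\int[P]_w (f w)%:E <= a%:E)%E -> (\int[P]_w (k * f w)%:E <= (k * a)%:E)%E.
Proof.
move=> k0 mf f0 fa; under eq_integral do rewrite EFinM.
rewrite ge0_integralZl//; first by rewrite EFinM lee_wpmul2l.
- exact/measurable_EFinP.
- by move=> w _; rewrite lee_fin.
Qed.

Lemma integral_sum_le (I : finType) (D : pred I) (f : I -> T -> R)
    (a : I -> R) :
  (forall i, D i -> measurable_fun setT (f i)) ->
  (forall i w, D i -> 0 <= f i w) ->
  (forall i, D i -> \int[P]_w (f i w)%:E <= (a i)%:E)%E ->
  (\int[P]_w (\sum_(i | D i) f i w)%:E <= (\sum_(i | D i) a i)%:E)%E.
Proof.
move=> mf f0 fa; rewrite big_mkcond/= -sumEFin.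
under eq_integral do rewrite big_mkcond/= -sumEFin.
rewrite ge0_integral_sum//=.
- apply: lee_sum => i _; case: (boolP (D i)) => [/fa //|_].
  by rewrite integral0.
- by move=> i; case: (boolP (D i)) => // Di; exact/measurable_EFinP/mf.
- by move=> i w _; rewrite lee_fin; case: ifP => // Di; exact: f0.
Qed.

End IntegralBounds.

(** * The risk bound against a fixed model *)

Section RiskBound.
Context {R : realType}.
Variables (gamma sigma : R) (n p : nat) (X : 'M[R]_(n, p)) (beta : 'cV[R]_p).
Variables (prior : nat -> R) (d : measure_display) (T : measurableType d).
Variables (P : probability T R) (eps : 'I_n -> {RV P >-> R}).
Variable Mhat : T -> {set 'I_p}.
Local Notation r := (\rank X).
Local Notation mu := (X *m beta).
Local Notation e w := (\col_i eps i w : 'cV[R]_n).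
Local Notation pen := (penalty (p := p) gamma sigma r prior).
Let c := 8 * (gamma + 3 / 4) ^+ 2.
Hypothesis gamma0 : 0 < gamma.
Hypothesis sigma0 : 0 < sigma.
Hypothesis freeX :
  forall f : 'I_r -> 'I_p, injective f -> row_free (colsub f X)^T.
Hypothesis gauss : gaussian_noise sigma eps.
Hypothesis prior0 : forall k, (k <= r)%N -> 0 < prior k.
Hypothesis prior1 : \sum_(k < r.+1) prior k = 1.
Hypothesis prior_lt : forall k, (k < r)%N ->
  prior k <= 'C(p, k)%:R * expR (- (c * k%:R)).
Hypothesis prior_r : prior r <= expR (- (c * r%:R)).
Hypothesis Mhat_sol : forall w, is_solution X r pen (mu + e w) (Mhat w).

Let r_le_p : (r <= p)%N. Proof. exact: rank_leq_col. Qed.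

Let rho : R := (2 * (1 + gamma))^-1.
Let th : R := 1 - rho.
Let t : R := th / (2 * sigma ^+ 2).
(** Chosen so that [kappa ^+ 2 / 2 = t * (2 - th)], the coefficient of the quadratic part of
    [t * Z_M]. *)
Let kappa : R := Num.sqrt (1 - rho ^+ 2) / sigma.

Let rho0 : 0 < rho. Proof. by rewrite invr_gt0 mulr_gt0// addr_gt0. Qed.
Let rho_lt1 : rho < 1.
Proof. by rewrite invf_lt1 ?mulr_gt0 ?addr_gt0//; move: gamma0; lra. Qed.
Let th0 : 0 < th. Proof. by rewrite subr_gt0. Qed.
Let s20 : 0 < 2 * sigma ^+ 2. Proof. by rewrite mulr_gt0// exprn_gt0. Qed.
Let t0 : 0 < t. Proof. exact: divr_gt0. Qed.

Let kappaE : kappa ^+ 2 = (1 - rho ^+ 2) / sigma ^+ 2.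
Proof.
rewrite /kappa expr_div_n sqr_sqrtr// subr_ge0 exprn_ile1// ltW//.
Qed.

Let rhoE : rho ^+ 2 + sigma ^+ 2 * kappa ^+ 2 = 1.
Proof. by rewrite kappaE mulrC divfK ?subrKC// expf_neq0// gt_eqF. Qed.

Let Q M := model_projector X M.

(* [t * Z_M = excess M + offset M], split into random and constant parts. *)
Let excess M w := dot ((2 * t) *: (Q M *m mu - mu)) (e w)
  + kappa ^+ 2 / 2 * dot (e w) (Q M *m e w).
Let offset M : R := - (t * th * sqnorm (Q M *m mu - mu)) - t * pen #|M|.

Let weight k : R := model_weight p r k.

(** The bias vector is killed by [Q M], so the quadratic moment bound applies; its linear part gives
    [2 * sigma ^+ 2 * t ^+ 2], equal to [t * th] by the choice of [t]. *)
Let integral_excess (M : {set 'I_p}) : (#|M| <= r)%N ->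
  (\int[P]_w (expR (excess M w))%:E
    <= (rho ^- #|M| * expR (t * th * sqnorm (Q M *m mu - mu)))%:E)%E.
Proof.
move=> Mr; have [_ QQ] : orth_projector (Q M) := model_projectorP X M.
have Qv : Q M *m ((2 * t) *: (Q M *m mu - mu)) = 0.
  by rewrite -scalemxAr mulmxBr (mulmxA (Q M) (Q M)) QQ subrr scaler0.
apply: le_trans (integral_expR_quad_noise sigma0 gauss rho0 rhoE
  (model_projectorP X M) Qv (rank_model_projector X M)) _.
rewrite lee_fin le_eqVlt; apply/orP; left; apply/eqP; congr (_ * expR _).
rewrite !sqnormE dotZl dotZr; move: (dot _ _) => q.
have s0 : sigma != 0 by rewrite gt_eqF.
by rewrite /t; field.
Qed.

Let measurable_excess M : measurable_fun setT (fun w => expR (excess M w)).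
Proof.
apply: measurableT_comp => //; apply: measurable_funD.
  exact: measurable_dot_noise.
by apply: measurable_funM => //; exact: measurable_quad_noise.
Qed.

(** Below size [r] the selected model has its own term, of weight 1. At size [r] all ['C(p, r)] sets
    share one projector, hence equal terms whose weights add up to 1. *)
Let excess_sum_ge w : expR (excess (Mhat w) w + offset (Mhat w))
  <= \sum_(M : {set 'I_p} | (#|M| <= r)%N)
       weight #|M| * expR (offset M) * expR (excess M w).
Proof.
have [Mr _] := Mhat_sol w.
have term (M : {set 'I_p}) : weight #|M| * expR (offset M) * expR (excess M w) =
    weight #|M| * expR (excess M w + offset M).
  by rewrite [in RHS]expRD; ring.
under eq_bigr do rewrite term.
have term_ge0 (M : {set 'I_p}) : (#|M| <= r)%N ->
    0 <= weight #|M| * expR (excess M w + offset M).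
  by move=> ?; rewrite mulr_ge0 ?expR_ge0// model_weight_ge0.
move: Mr; rewrite leq_eqVlt => /predU1P[Mr|Mr]; last first.
  rewrite (bigD1 (Mhat w)) ?(ltnW Mr)//=.
  have -> : weight #|Mhat w| = 1.
    rewrite /weight /model_weight Mr divff// gt_eqF//.
    exact: (@model_count_gt0 _ _ _ r_le_p _ (ltnW Mr)).
  by rewrite mul1r lerDl sumr_ge0// => M /andP[? _]; exact: term_ge0.
rewrite (bigID (fun M : {set 'I_p} => #|M| == r))/=.
rewrite -[leLHS]addr0 lerD//; last first.
  by rewrite sumr_ge0// => M /andP[? _]; exact: term_ge0.
rewrite (eq_bigl (fun M : {set 'I_p} =>
  M \in [set M : {set 'I_p} | #|M| == r]%SET)); last first.
  by move=> M; rewrite inE andb_idl// => /eqP ->.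
rewrite (eq_bigr (fun=> 'C(p, r)%:R^-1 *
  expR (excess (Mhat w) w + offset (Mhat w)))); last first.
  move=> M; rewrite inE => /eqP MM; rewrite /weight /model_weight MM ltnn mul1r.
  have QE : Q M = Q (Mhat w) by rewrite /Q !saturated_model_projector.
  by rewrite /excess /offset QE MM Mr.
rewrite sumr_const card_draws card_ord -mulrnAl -[_ *+ _]mulr_natr.
rewrite mulVf ?mul1r//.
by rewrite gt_eqF// (@model_count_gt0 _ _ _ r_le_p).
Qed.

Let integral_excess_sum :
  (\int[P]_w (\sum_(M : {set 'I_p} | (#|M| <= r)%N)
       weight #|M| * expR (offset M) * expR (excess M w))%:E <= 1%:E)%E.
Proof.
have w0 (M : {set 'I_p}) : (#|M| <= r)%N -> 0 <= weight #|M| * expR (offset M).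
  by move=> ?; rewrite mulr_ge0 ?expR_ge0// model_weight_ge0.
have := sum_penalty_weights gamma0 sigma0 r_le_p prior0 prior_lt prior_r prior1.
rewrite -lee_fin; apply: le_trans.
apply: integral_sum_le => [M Mr|M w Mr|M Mr].
- by apply: measurable_funM => //; exact: measurable_excess.
- by rewrite mulr_ge0 ?expR_ge0 ?w0.
apply: le_trans (integralZ_le (w0 M Mr) (measurable_excess M) _
  (integral_excess Mr)) _.
  by move=> w; exact: expR_ge0.
rewrite lee_fin -[leLHS]mulrA ler_wpM2l ?model_weight_ge0//.
rewrite mulrCA -expRD ler_wpM2l ?invr_ge0 ?exprn_ge0 ?(ltW rho0)//.
by rewrite ler_expR /offset addrAC addNr add0r.
Qed.

Lemma expected_risk_le (M : {set 'I_p}) : (#|M| <= r)%N ->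
  ('E_P[fun w => sqnorm (X *m lse X (Mhat w) (mu + e w) - mu)]
    <= (4 * (1 + gamma) * (sqnorm (model_proj X M mu - mu) + pen #|M|)
        + 4 * (1 + gamma) * (1 + (1 - rho)^-1) * sigma ^+ 2)%:E)%E.
Proof.
move=> Mr; set u := mu - Q M *m mu.
have uE : sqnorm (Q M *m mu - mu) = sqnorm u.
  by rewrite -opprB !sqnormE dotNl dotNr opprK.
have sN0 : sigma != 0 by rewrite gt_eqF.
have rN0 : rho != 0 by rewrite gt_eqF.
have thN0 : th != 0 by rewrite gt_eqF.
(* Random factor of the exponential bound on [2 * dot u (e w) - sqnorm u] at scale
   [(2 * sigma ^+ 2)^-1]. The constant factor is [b] below, and the expectation of [b * lin] is at
   most [2 * sigma ^+ 2]. *)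
pose lin w := expR (dot (sigma ^- 2 *: u) (e w)).
have mlin : measurable_fun setT lin.
  by apply: measurableT_comp => //; exact: measurable_dot_noise.
have lin0 w : 0 <= lin w by exact: expR_ge0.
pose S w := \sum_(M : {set 'I_p} | (#|M| <= r)%N)
       weight #|M| * expR (offset M) * expR (excess M w).
have mS : measurable_fun setT S.
  rewrite /S; under eq_fun do rewrite -big_filter.
  by apply: measurable_sum => M'; exact: measurable_funM.
have S0 w : 0 <= S w.
  apply: sumr_ge0 => M' M'r; apply: mulr_ge0; last exact: expR_ge0.
  by apply: mulr_ge0; [exact: model_weight_ge0|exact: expR_ge0].
(* One [sqnorm u] is the bias of [M]; the other compensates the one subtracted from the linear
   term. *)
pose K : R := 2 * sqnorm u + pen #|M|.
pose b : R := 2 * sigma ^+ 2 * expR (- (sqnorm u / (2 * sigma ^+ 2))).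
have pen0 : 0 <= pen #|M|.
  exact: penalty_ge0 gamma0 r_le_p prior0 prior_lt prior_r _ Mr.
have b0 : 0 <= b by rewrite mulr_ge0 ?expR_ge0// ltW.
have K0 : 0 <= K by rewrite addr_ge0// mulr_ge0 ?sqnorm_ge0.
have ti0 : 0 <= t^-1 by rewrite invr_ge0 ltW.
have path w : sqnorm (X *m lse X (Mhat w) (mu + e w) - mu)
    <= rho^-1 * (K + (b * lin w + t^-1 * S w)).
  rewrite model_proj_lse model_projE -/(Q _) ler_pdivlMl//.
  have [_ /(_ M Mr)] := Mhat_sol w.
  rewrite !model_proj_lse !model_projE -/(Q _) -/(Q _).
  move=> /(selection_risk_bound th (model_projectorP X M)
    (model_projectorP X _)).
  rewrite -/(Q _) -/(Q _) -/u uE subKr => /le_trans; apply.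
  set z := (_ - pen #|Mhat w|).
  have zS : z <= t^-1 * S w.
    apply: le_trans (ler_expR_scaled z t0) _.
    rewrite ler_wpM2l//; apply: le_trans (excess_sum_ge w).
    rewrite ler_expR le_eqVlt; apply/orP; left; apply/eqP.
    rewrite /z /excess /offset dotZl kappaE /t /th.
    move: (dot _ _) (dot _ _) (sqnorm _) (pen _) => q1 q2 q3 q4; field.
    exact: sN0.
  have linS : 2 * dot u (e w) - sqnorm u <= b * lin w.
    have si0 : 0 < (2 * sigma ^+ 2)^-1 by rewrite invr_gt0.
    apply: le_trans (ler_expR_scaled _ si0) _.
    rewrite invrK /b /lin -mulrA -expRD ler_wpM2l ?(ltW s20)// ler_expR.
    rewrite le_eqVlt; apply/orP; left; apply/eqP; rewrite dotZl.
    by field.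
  rewrite /K; lra.
have linE : (\int[P]_w (lin w)%:E <= (expR (sqnorm u / (2 * sigma ^+ 2)))%:E)%E.
  rewrite (integral_expR_dot_noise sigma0 gauss) lee_fin ler_expR.
  rewrite le_eqVlt; apply/orP; left; apply/eqP.
  by rewrite !sqnormE dotZl dotZr; field.
have KE : (\int[P]_(w in setT) (cst K w)%:E <= K%:E)%E.
  rewrite (integral_cst _ _ K%:E)// -[leRHS]mule1.
  by apply: lee_wpmul2l => //; exact: probability_le1.
rewrite unlock; apply: (@le_trans _ _
    (\int[P]_w (rho^-1 * (K + (b * lin w + t^-1 * S w)))%:E)%E).
  by apply: ge0_le_integral_nonmeasurable => w; rewrite lee_fin ?sqnorm_ge0.
have mbS : measurable_fun setT (fun w => b * lin w + t^-1 * S w).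
  by apply: measurable_funD; apply: measurable_funM.
have bS0 w : 0 <= b * lin w + t^-1 * S w by rewrite addr_ge0// mulr_ge0.
apply: (@le_trans _ _ (rho^-1 * (K + (2 * sigma ^+ 2 + t^-1 * 1)))%:E).
  apply: integralZ_le => [||w|].
  - by rewrite ltW// invr_gt0.
  - exact: measurable_funD.
  - exact: addr_ge0.
  apply: integralD_le => //.
  have -> : 2 * sigma ^+ 2 = b * expR (sqnorm u / (2 * sigma ^+ 2)).
    by rewrite /b -mulrA -expRD addNr expR0 mulr1.
  apply: integralD_le => [|w||w||].
  - exact: measurable_funM.
  - exact: mulr_ge0.
  - exact: measurable_funM.
  - exact: mulr_ge0.
  - exact: integralZ_le.
  - exact: integralZ_le.
rewrite lee_fin model_projE -/(Q M) uE mulr1.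
have -> : rho^-1 = 2 * (1 + gamma) by rewrite invrK.
have -> : t^-1 = 2 * sigma ^+ 2 * th^-1 by rewrite /t invfM invrK mulrC.
rewrite -/th /K.
have q0 := sqnorm_ge0 u.
have g10 : 0 <= 1 + gamma by rewrite addr_ge0// ltW.
(* The two sides differ exactly by this slack: the bias carries [2 * rho^-1 = 4 * (1 + gamma)], the
   penalty only [rho^-1]. *)
have gp := mulr_ge0 (mulr_ge0 (ler0n R 2) g10) pen0.
rewrite -subr_ge0; move: gp; congr (0 <= _).
by ring.
Qed.

End RiskBound.

(** * Passage to the infimum over models *)

Theorem theorem1 (R : realType) (gamma : R) (hgamma : 0 < gamma) :
  let c := 8 * (gamma + 3 / 4) ^+ 2 in
  exists c0 c1 : R,
    forall (n p r : nat) (X : 'M[R]_(n, p)) (beta : 'cV[R]_p) (sigma : R)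
      (prior : nat -> R)
      (d : measure_display) (T : measurableType d) (P : probability T R)
      (eps : 'I_n -> {RV P >-> R}) (Mhat : T -> {set 'I_p}),
    let y := fun w : T => X *m beta + \col_i eps i w in
    let pen := penalty (p := p) gamma sigma r prior in
    \rank X = r ->
    (forall f : 'I_r -> 'I_p, injective f -> row_free (colsub f X)^T) ->
    0 < sigma ->
    gaussian_noise sigma eps ->
    (forall k, (k <= r)%N -> 0 < prior k) ->
    \sum_(k < r.+1) prior k = 1 ->
    (forall k, (k < r)%N -> prior k <= 'C(p, k)%:R * expR (- (c * k%:R))) ->
    prior r <= expR (- (c * r%:R)) ->
    (forall w, is_solution X r pen (y w) (Mhat w)) ->
    ('E_P[fun w => sqnorm (X *m lse X (Mhat w) (y w) - X *m beta)]
      <= (c0 * oracle_risk X r pen beta + c1 * sigma ^+ 2)%:E)%E.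
Proof.
move=> c; pose rho : R := (2 * (1 + gamma))^-1.
exists (4 * (1 + gamma)), (4 * (1 + gamma) * (1 + (1 - rho)^-1)).
move=> n p r X beta sigma prior d T P eps Mhat y pen rX.
move: rX @pen => <- pen freeX sigma0 gauss prior0 prior1 prior_lt prior_r sol.
have c0 : 0 < 4 * (1 + gamma) by rewrite mulr_gt0// addr_gt0.
have bound := expected_risk_le hgamma sigma0 freeX gauss prior0 prior1
  prior_lt prior_r sol.
rewrite -/rho in bound.
set E := 'E_P[_]%E in bound *.
(* The bound at the empty model makes the risk finite, so that it can be compared in [R] with a real
   infimum. *)
have Efin : E \is a fin_num.
  rewrite ge0_fin_numE.
    by apply: le_lt_trans (bound finset.set0 _) (ltry _); rewrite cards0.
  by rewrite /E unlock; apply: integral_ge0 => w _; rewrite lee_fin sqnorm_ge0.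
rewrite -(fineK Efin) lee_fin -lerBlDr -ler_pdivrMl//.
apply: lb_le_inf.
  by eexists; exists finset.set0 => //=; rewrite cards0.
move=> _ [M /= Mr <-]; rewrite ler_pdivrMl// lerBlDr.
by rewrite -lee_fin (fineK Efin); exact: bound.
Qed.
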